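(* Let $P_D \subset B_3$ be the positive cone of the Dehornoy ordering of the braid group $B_3$, and let $F_2 = [B_3,B_3]$ be the commutator subgroup of $B_3$ (which is a free group of rank $2$). Let $<$ be the left ordering of $F_2$ whose positive cone is $P = [B_3,B_3] \cap P_D$, i.e. the restriction of the Dehornoy ordering to $[B_3,B_3]$. Then the ordering $<$ of $F_2$ has no proper, nontrivial convex subgroups; that is, if $C \subset F_2$ is a subgroup convex with respect to $<$, then $C = \{1\}$ or $C = F_2$.
   Context: Left orderings: a left ordering of a group $G$ is a strict total ordering $<$ of its elements such that $g<h$ implies $fg<fh$ for all $f,g,h \in G$. Its positive cone is $P=\{g\in G : g>1\}$, which satisfies $P\cdot P\subset P$ and $P\sqcup P^{-1}\sqcup\{1\}=G$; conversely any subset $P$ with these two properties defines a left ordering by $g<h$ if and only if $g^{-1}h\in P$. Convex subgroups: a subgroup $H\subset G$ is convex with respect to $<$ if whenever $f,h\in H$, $g\in G$ and $f<g<h$, then $g\in H$. Braid group: $B_3=\langle \sigma_1,\sigma_2 \mid \sigma_1\sigma_2\sigma_1=\sigma_2\sigma_1\sigma_2\rangle$. Dehornoy ordering: for $i\in\{1,2\}$, a word in the generators $\sigma_i,\dots,\sigma_2$ and their inverses is $i$-positive if the generator $\sigma_i$ occurs in it and occurs only with positive exponents. (So a $1$-positive word is a word in $\sigma_1^{\pm1},\sigma_2^{\pm1}$ containing $\sigma_1$ but not $\sigma_1^{-1}$, and a $2$-positive word is a positive power of $\sigma_2$.) A braid is $i$-positive if it is represented by some $i$-positive word. The set $P_D=\{\beta\in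 B_3 : \beta \text{ is } i\text{-positive for some } i\le 2\}$ is the positive cone of a left ordering of $B_3$, called the Dehornoy ordering (known theorem of Dehornoy). It is known that $[B_3,B_3]$ is free of rank $2$, freely generated by $\sigma_1\sigma_2^{-1}$ and $\sigma_1^2\sigma_2^{-2}$. *)

(* Defs.v *)
From HB Require Import structures.
From mathcomp Require Import all_boot.
From mathcomp Require Import boolp classical_sets.

Set Implicit Arguments.
Unset Strict Implicit.
Unset Printing Implicit Defensive.

Local Open Scope quotient_scope.
Local Open Scope classical_set_scope.
Local Open Scope group_scope.

(* The generator sigma_(i+1) of B_3 is indexed by i : 'I_2. The letter
   (i, true) stands for sigma_(i+1), and (i, false) for its inverse. *)
Definition letter : Type := 'I_2 * bool.
Definition word : Type := seq letter.

Definition inv_letter (l : letter) : letter := (l.1, ~~ l.2).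
Definition inv_word (w : word) : word := rev (map inv_letter w).

Definition sig1 : letter := (ord0, true).
Definition sig2 : letter := (ord_max, true).

(* Equality in the group presented by
   < sigma_1, sigma_2 | sigma_1 sigma_2 sigma_1 = sigma_2 sigma_1 sigma_2 >. *)
Inductive braid_eq : word -> word -> Prop :=
| braid_eq_refl w : braid_eq w w
| braid_eq_sym v w : braid_eq v w -> braid_eq w v
| braid_eq_trans u v w : braid_eq u v -> braid_eq v w -> braid_eq u w
| braid_eq_cat u u' v v' :
    braid_eq u u' -> braid_eq v v' -> braid_eq (u ++ v) (u' ++ v')
| braid_eq_cancel l : braid_eq [:: l; inv_letter l] [::]
| braid_eq_rel : braid_eq [:: sig1; sig2; sig1] [:: sig2; sig1; sig2].

Definition braid_eqb : rel word := fun v w => `[< braid_eq v w >].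

Lemma braid_eqb_refl : reflexive braid_eqb.
Proof. by move=> w; apply/asboolP/braid_eq_refl. Qed.

Lemma braid_eqb_sym : symmetric braid_eqb.
Proof. by move=> v w; apply/asboolP/asboolP; exact: braid_eq_sym. Qed.

Lemma braid_eqb_trans : transitive braid_eqb.
Proof.
move=> v u w /asboolP uv /asboolP vw.
by apply/asboolP; exact: braid_eq_trans uv vw.
Qed.

Canonical braid_equiv :=
  EquivRel braid_eqb braid_eqb_refl braid_eqb_sym braid_eqb_trans.

Definition B3 : Type := {eq_quot braid_equiv}.

HB.instance Definition _ := Choice.on B3.

Definition braid (w : word) : B3 := \pi_B3 w.

Lemma braidP v w : braid v = braid w <-> braid_eq v w.
Proof.
split=> [/eqmodP /asboolP //|vw].
by apply/eqmodP/asboolP.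
Qed.

Lemma braid_repr (x : B3) : braid (repr x) = x.
Proof. exact: reprK. Qed.

Lemma repr_braid w : braid_eq (repr (braid w)) w.
Proof. by apply/braidP; rewrite braid_repr. Qed.

Lemma inv_letterK : involutive inv_letter.
Proof. by case=> i e; rewrite /inv_letter /= negbK. Qed.

Lemma inv_word_cat v w : inv_word (v ++ w) = inv_word w ++ inv_word v.
Proof. by rewrite /inv_word map_cat rev_cat. Qed.

Lemma inv_wordK : involutive inv_word.
Proof. by move=> w; rewrite /inv_word map_rev revK (mapK inv_letterK). Qed.

Lemma braid_eq_mulwV w : braid_eq (w ++ inv_word w) [::].
Proof.
elim: w => [|l w IHw]; first exact: braid_eq_refl.
rewrite -cat1s inv_word_cat -catA [w ++ _]catA.
apply: braid_eq_trans (braid_eq_cancel l).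
apply: (@braid_eq_cat [:: l] [:: l]); first exact: braid_eq_refl.
exact: (@braid_eq_cat _ [::] _ [:: inv_letter l] IHw (braid_eq_refl _)).
Qed.

Lemma braid_eq_mulVw w : braid_eq (inv_word w ++ w) [::].
Proof. by have := braid_eq_mulwV (inv_word w); rewrite inv_wordK. Qed.

Lemma braid_eq_inv v w : braid_eq v w -> braid_eq (inv_word v) (inv_word w).
Proof.
move=> vw; have r := braid_eq_refl.
have e1 : braid_eq (inv_word v) (inv_word v ++ (w ++ inv_word w)).
  apply: braid_eq_sym; rewrite -[X in braid_eq _ X]cats0.
  exact: braid_eq_cat (r _) (braid_eq_mulwV w).
apply: braid_eq_trans e1 _; rewrite catA -[X in braid_eq _ X]cat0s.
apply: braid_eq_cat (r _); apply: braid_eq_trans (braid_eq_mulVw v).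
exact: braid_eq_cat (r _) (braid_eq_sym vw).
Qed.

Definition B3_one : B3 := braid [::].
Definition B3_mul (x y : B3) : B3 := braid (repr x ++ repr y).
Definition B3_inv (x : B3) : B3 := braid (inv_word (repr x)).

Lemma B3_mulE v w : B3_mul (braid v) (braid w) = braid (v ++ w).
Proof. by apply/braidP; apply: braid_eq_cat; exact: repr_braid. Qed.

Lemma B3_invE w : B3_inv (braid w) = braid (inv_word w).
Proof. by apply/braidP; apply: braid_eq_inv; exact: repr_braid. Qed.

Lemma B3_mulA : associative B3_mul.
Proof.
move=> x y z; rewrite -(braid_repr x) -(braid_repr y) -(braid_repr z).
by rewrite !B3_mulE catA.
Qed.

Lemma B3_mul1 : left_id B3_one B3_mul.
Proof. by move=> x; rewrite -(braid_repr x) B3_mulE. Qed.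

Lemma B3_mulr1 : right_id B3_one B3_mul.
Proof. by move=> x; rewrite -(braid_repr x) B3_mulE cats0. Qed.

Lemma B3_mulV : left_inverse B3_one B3_inv B3_mul.
Proof.
move=> x; rewrite -(braid_repr x) B3_invE B3_mulE.
by apply/braidP; exact: braid_eq_mulVw.
Qed.

Lemma B3_mulrV : right_inverse B3_one B3_inv B3_mul.
Proof.
move=> x; rewrite -(braid_repr x) B3_invE B3_mulE.
by apply/braidP; exact: braid_eq_mulwV.
Qed.

HB.instance Definition _ := isGroup.Build B3
  B3_mulA B3_mul1 B3_mulr1 B3_mulV B3_mulrV.

Lemma braidM v w : braid (v ++ w) = braid v * braid w.
Proof. by rewrite -B3_mulE. Qed.

Lemma braidV w : braid (inv_word w) = (braid w)^-1.
Proof. by rewrite -B3_invE. Qed.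

Lemma braid1 : braid [::] = 1.
Proof. by []. Qed.

(* With the shift of indices above, i = 0 and i = 1 are the 1-positive and
   2-positive words. *)
Definition ipositive_word (i : 'I_2) (w : word) : bool :=
  [&& all (fun l : letter => i <= l.1) w,
      has (fun l : letter => l.1 == i) w
    & all (fun l : letter => (l.1 == i) ==> l.2) w].

Definition ipositive (i : 'I_2) (b : B3) : Prop :=
  exists2 w, ipositive_word i w & braid w = b.

Definition dehornoy_cone : set B3 := [set b | exists i, ipositive i b].

Definition subgroup (G : groupType) (H : set G) : Prop :=
  group_closed (mem H).

Definition commutator_subgroup (G : groupType) : set G :=
  smallest (@subgroup G) [set z | exists x y : G, z = [~ x, y]].
Arguments commutator_subgroup G : clear implicits.

Definition cone_lt (G : groupType) (P : set G) (g h : G) : Prop :=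
  P (g^-1 * h).

(* Convexity of C inside the subgroup F, on which lt is an ordering. *)
Definition convex_in (G : groupType) (F : set G) (lt : G -> G -> Prop)
    (C : set G) : Prop :=
  forall f g h : G, C f -> C h -> F g -> lt f g -> lt g h -> C g.

(* Main.v *)
Require Import Defs.
From mathcomp Require Import all_boot.
From mathcomp Require Import boolp classical_sets.
From mathcomp Require Import ssralg ssrint.

(** Why the theorem holds. Put u = sigma2^-1 sigma1 and
    t_n = sigma2^-n u sigma2^n. Every t_n is a commutator and equals
    sigma2^-(n+1) sigma1 sigma2^n, so it is a positive element of F2. The
    sequence decreases to 1 in the following sense: if c is 1-positive, then
    t_n < c for all large n ([descent_small]). Indeed c starts with
    sigma2^k sigma1 for some integer k, and in t_n^-1 c the letter sigma1^-1
    is then followed by a positive power of sigma2 and a sigma1; the identity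
    sigma1^-1 sigma2 sigma1 = sigma2 sigma1 sigma2^-1 makes it disappear and
    leaves a 1-positive word.

    Let C be convex and contain some c <> 1. Up to inversion c is represented
    by a word without sigma1^-1 ([s1_nonneg_total]). Such a word is either
    1-positive or a power of sigma2, and the exponent sum rules the latter out
    in F2 ([commutator_s2]). By convexity C contains t_n for all large n.
    The braid relation reads t_(n+2) t_n = t_(n+1), so that C contains t_n for
    every integer n, and these elements generate F2 ([descent_generate]): the
    elements all of whose conjugates by powers of sigma2 lie in C form a normal
    subgroup of B_3 that contains u, and modulo u the two generators agree.

    The existence half of Dehornoy's theorem, [s1_nonneg_total], is proved by
    means of the Garside element Delta = sigma1 sigma2 sigma1: up to powers of
    Delta, every braid is a product of factors sigma1 and sigma2^-1, or of
    factors sigma2 and sigma1^-1. This mirrors the fact that a matrix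
    in SL_2(Z) has nonnegative entries up to rotations by a quarter turn. *)

Set Implicit Arguments.
Unset Strict Implicit.
Unset Printing Implicit Defensive.

Local Open Scope classical_set_scope.
Local Open Scope group_scope.

(** * Subgroups and commutators *)

Section Subgroups.
Variable G : groupType.
Implicit Types (H K : set G) (x y g : G).

Lemma subgroup1 H : subgroup H -> H 1.
Proof. by case=> /set_mem. Qed.

Lemma subgroupF H x y : subgroup H -> H x -> H y -> H (x / y).
Proof. by case=> _ HF /mem_set Hx /mem_set Hy; apply/set_mem/HF. Qed.

Lemma subgroupV H x : subgroup H -> H x -> H x^-1.
Proof.
by move=> sH Hx; rewrite -div1g; apply: subgroupF => //; exact: subgroup1.
Qed.

Lemma subgroupM H x y : subgroup H -> H x -> H y -> H (x * y).
Proof.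
move=> sH Hx Hy; rewrite -[y]invgK.
by apply: subgroupF => //; exact: subgroupV.
Qed.

Lemma subgroupP H : H 1 -> (forall x y, H x -> H y -> H (x * y)) ->
  (forall x, H x -> H x^-1) -> subgroup H.
Proof.
move=> H1 HM HV; split; first exact: mem_set.
by move=> x y /set_mem Hx /set_mem Hy; apply/mem_set/HM => //; exact: HV.
Qed.

Lemma commutator_subgroup_sub H : subgroup H ->
  (forall x y, H [~ x, y]) -> commutator_subgroup G `<=` H.
Proof. by move=> sH HR x; apply; split=> // z [y [t ->]]. Qed.

Lemma commutator_subgroupR x y : commutator_subgroup G [~ x, y].
Proof. by move=> H [_]; apply; exists x, y. Qed.

Lemma subgroup_commutator : subgroup (commutator_subgroup G).
Proof.
apply: subgroupP => [H [sH _]|x y Fx Fy H sHR|x Fx H sHR].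
- exact: subgroup1.
- by case: (sHR) => sH _; apply: subgroupM => //; [exact: Fx|exact: Fy].
- by case: (sHR) => sH _; apply: subgroupV => //; exact: Fx.
Qed.

(** This is the preimage in G of the centraliser of the image of y in G / K. *)
Lemma subgroup_commute_mod K y : subgroup K ->
  (forall x g, K x -> K (x ^ g)) -> subgroup [set x | K [~ x, y]].
Proof.
move=> sK nK; apply: subgroupP => /= [|x z Kx Kz|x Kx].
- by rewrite comm1g; exact: subgroup1.
- rewrite (_ : [~ _, _] = [~ x, y] ^ z * [~ z, y]).
    by apply: subgroupM => //; exact: nK.
  by rewrite /commg /conjg !invgM !mulgA !mulgK.
- rewrite (_ : [~ _, _] = ([~ x, y] ^ x^-1)^-1).
    by apply: subgroupV => //; exact: nK.
  by rewrite /commg /conjg !invgM !invgK !mulgA ?mulgK ?mulgVK.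
Qed.

End Subgroups.

(** * Garside normal form modulo powers of Delta *)

Section BraidRelation.
Variable G : groupType.
Implicit Types (a b c d x y g l : G).

(** The submonoid generated by a and b. *)
Inductive mono a b : G -> Prop :=
| mono1 : mono a b 1
| monoMl x : mono a b x -> mono a b (x * a)
| monoMr x : mono a b x -> mono a b (x * b).

Lemma mono_conj c d x g : mono c d x -> mono (c ^ g) (d ^ g) (x ^ g).
Proof.
elim=> [|y _ IH|y _ IH]; first by rewrite conj1g; exact: mono1.
  by rewrite conjMg; exact: monoMl.
by rewrite conjMg; exact: monoMr.
Qed.

Definition mixed a b x := mono a b^-1 x \/ mono b a^-1 x.

Variables a b : G.
Hypothesis ab : a * b * a = b * a * b.
Let D := a * b * a.

Lemma garside_conjl : a ^ D = b.
Proof.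
by rewrite /conjg; apply: (mulgI D); rewrite mulVKg /D {1}ab !mulgA.
Qed.

Lemma garside_conjr : b ^ D = a.
Proof.
by rewrite /conjg; apply: (mulgI D); rewrite mulVKg /D !mulgA -ab.
Qed.

Lemma mono_garside x : mono a b^-1 x -> mono b a^-1 (x ^ D).
Proof.
by move=> /(mono_conj D); rewrite conjVg garside_conjl garside_conjr.
Qed.

Lemma mono_garsideV x : mono a b^-1 x -> mono b a^-1 (x ^ D^-1).
Proof.
move=> /(mono_conj D^-1); rewrite conjVg.
by rewrite -{1}garside_conjr -{2}garside_conjl !conjgK.
Qed.

(** Appending a generator either extends or shortens the word x, or it creates
    a subword a b = Delta a^-1 or b^-1 a^-1 = Delta^-1 b. In the last two cases
    the power of Delta moves to the front, and conjugation by it exchanges a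
    and b in the rest of x. *)
Lemma mono_step x l :
  mono a b^-1 x -> [\/ l = a, l = a^-1, l = b | l = b^-1] ->
  exists2 y, mixed a b y & [\/ x * l = y, x * l = D * y | D * (x * l) = y].
Proof.
move=> Mx; case=> ->.
- by exists (x * a); [left; exact: monoMl | constructor 1].
- case: Mx => [|y My|y My].
  + exists a^-1; last by constructor 1; rewrite mul1g.
    by right; have := monoMr (mono1 b a^-1); rewrite mul1g.
  + by exists y; [left | constructor 1; rewrite mulgK].
  + exists (y ^ D^-1 * b).
      by right; apply: monoMl; exact: mono_garsideV.
    constructor 3; rewrite /conjg invgK -!mulgA; congr (_ * (_ * _)).
    by rewrite /D ab !invgM !mulgA mulgVK.
- case: Mx => [|y My|y My].
  + exists b; last by constructor 1; rewrite mul1g.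
    by right; have := monoMl (mono1 b a^-1); rewrite mul1g.
  + exists (y ^ D * a^-1).
      by right; apply: monoMr; exact: mono_garside.
    by constructor 2; rewrite mulgA -conjgC /D !mulgA mulgK.
  + by exists y; [left | constructor 1; rewrite mulgVK].
- by exists (x * b^-1); [left; exact: monoMr | constructor 1].
Qed.

End BraidRelation.

Notation s1 := (braid [:: sig1]).
Notation s2 := (braid [:: sig2]).

Definition garside : B3 := s1 * s2 * s1.

Lemma braid_rel : s1 * s2 * s1 = s2 * s1 * s2.
Proof. by rewrite -!braidM; apply/braidP; exact: braid_eq_rel. Qed.

Lemma braid_letter l :
  [\/ braid [:: l] = s1, braid [:: l] = s1^-1, braid [:: l] = s2
    | braid [:: l] = s2^-1].
Proof.
case: l => -[[|[|//]] i]; rewrite -?braidV; case.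
- by constructor 1; congr (braid [:: (_, _)]); apply: val_inj.
- by constructor 2; congr (braid [:: (_, _)]); apply: val_inj.
- by constructor 3; congr (braid [:: (_, _)]); apply: val_inj.
- by constructor 4; congr (braid [:: (_, _)]); apply: val_inj.
Qed.

Lemma garside_form x : exists n m y,
  mixed s1 s2 y /\ garside ^+ n * x = garside ^+ m * y.
Proof.
rewrite -(braid_repr x); elim/last_ind: (repr x) => [|w l [n [m [y [My e]]]]].
  by exists 0, 0, 1; split; [left; exact: mono1 | rewrite mul1g].
have [z Mz st] : exists2 z, mixed s1 s2 z &
    [\/ y * braid [:: l] = z, y * braid [:: l] = garside * z
      | garside * (y * braid [:: l]) = z].
  case: My => My; first by have := mono_step braid_rel My (braid_letter l).
  (* The hypotheses of mono_step are symmetric in the two generators. *)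
  have [|z Mz] := mono_step (esym braid_rel) (l := braid [:: l]) My.
    by case: (braid_letter l);
      [constructor 3 | constructor 4 | constructor 1 | constructor 2].
  rewrite -braid_rel; exists z => //.
  by case: Mz; [right | left].
have e' : garside ^+ n * braid (rcons w l) = garside ^+ m * (y * braid [:: l]).
  by rewrite -cats1 braidM !mulgA e.
case: st => st.
- by exists n, m, z; rewrite e' st.
- by exists n, m.+1, z; rewrite e' st mulgA -expgSr.
- by exists n.+1, m, z; rewrite expgS -mulgA e' mulgA -expgS expgSr -mulgA st.
Qed.

(** * Braids represented by words without sigma1^-1 *)

Definition s1_nonneg (x : B3) : Prop :=
  exists2 w, all (fun l : letter => (l.1 == ord0) ==> l.2) w & braid w = x.

Lemma s1_nonneg1 : s1_nonneg 1.
Proof. by exists [::]. Qed.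

Lemma s1_nonnegM x y : s1_nonneg x -> s1_nonneg y -> s1_nonneg (x * y).
Proof.
by case=> v vP <- [w wP <-]; exists (v ++ w); rewrite ?all_cat ?vP // braidM.
Qed.

Lemma s1_nonnegX x n : s1_nonneg x -> s1_nonneg (x ^+ n).
Proof.
move=> Nx; elim: n => [|n IH]; first exact: s1_nonneg1.
by rewrite expgS; exact: s1_nonnegM.
Qed.

Lemma s1_nonneg_s1 : s1_nonneg s1.
Proof. by exists [:: sig1]. Qed.

Lemma s1_nonneg_s2 : s1_nonneg s2.
Proof. by exists [:: sig2]. Qed.

Lemma s1_nonneg_s2V : s1_nonneg s2^-1.
Proof. by exists [:: inv_letter sig2]; rewrite -?braidV. Qed.

Lemma s1_nonneg_garside : s1_nonneg garside.
Proof.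
apply: s1_nonnegM s1_nonneg_s1; exact: s1_nonnegM s1_nonneg_s1 s1_nonneg_s2.
Qed.

Lemma mono_s1_nonneg x : mono s1 s2^-1 x -> s1_nonneg x.
Proof.
elim=> [|y _ Ny|y _ Ny]; first exact: s1_nonneg1.
  exact: s1_nonnegM s1_nonneg_s1.
exact: s1_nonnegM s1_nonneg_s2V.
Qed.

Lemma mono_s1_nonnegV x : mono s2 s1^-1 x -> s1_nonneg x^-1.
Proof.
elim=> [|y _ Ny|y _ Ny]; first by rewrite invg1; exact: s1_nonneg1.
  by rewrite invgM; apply: s1_nonnegM s1_nonneg_s2V _.
by rewrite invgM invgK; apply: s1_nonnegM s1_nonneg_s1 _.
Qed.

(** Write x = Delta^k y with y in one of the two monoids of the normal form.
    If the sign of k agrees with the sign of the occurrences of sigma1 in y,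
    this is clear. Otherwise k <> 0, and moving one factor Delta^+-1 past y
    exchanges the two monoids and so corrects the sign in y. *)
Lemma s1_nonneg_total x : s1_nonneg x \/ s1_nonneg x^-1.
Proof.
have ND n : s1_nonneg (garside ^+ n).
  exact: s1_nonnegX s1_nonneg_garside.
have [n [m [y [My e]]]] := garside_form x.
have [le_nm|lt_mn] := leqP n m.
- have {e} -> : x = garside ^+ (m - n) * y.
    by apply: (mulgI (garside ^+ n)); rewrite e mulgA -expgnDr subnKC.
  case: My => My.
    by left; apply: s1_nonnegM (ND _) _; exact: mono_s1_nonneg.
  case: (m - n)%N => [|k].
    by right; rewrite mul1g; exact: mono_s1_nonnegV.
  left; rewrite expgSr -mulgA [garside * y]conjgCV.
  apply: s1_nonnegM (ND _) _.
  apply: s1_nonnegM s1_nonneg_garside; apply: mono_s1_nonneg.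
  by have := mono_garsideV (esym braid_rel) My; rewrite -braid_rel.
- have {e} -> : x = (garside ^+ (n - m))^-1 * y.
    apply: (mulgI (garside ^+ (n - m))); rewrite mulVKg.
    apply: (mulgI (garside ^+ m)); rewrite -e mulgA -expgnDr subnKC //.
    exact: ltnW.
  right; rewrite invgM invgK; case: My => My.
    rewrite -(subnSK lt_mn) expgS mulgA [y^-1 * _]conjgC conjVg.
    apply: s1_nonnegM (ND _); apply: s1_nonnegM s1_nonneg_garside _.
    exact/mono_s1_nonnegV/mono_garside/My/braid_rel.
  by apply: s1_nonnegM (ND _); exact: mono_s1_nonnegV.
Qed.

Lemma braid_letter_nonneg l : (l.1 == ord0) ==> l.2 ->
  [\/ braid [:: l] = s1, braid [:: l] = s2 | braid [:: l] = s2^-1].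
Proof.
case: l => -[[|[|//]] i]; rewrite -?braidV; case=> // _.
- by constructor 1; congr (braid [:: (_, _)]); apply: val_inj.
- by constructor 2; congr (braid [:: (_, _)]); apply: val_inj.
- by constructor 3; congr (braid [:: (_, _)]); apply: val_inj.
Qed.

(** The cases are whether or not sigma1 occurs; in the second one the word is
    cut at its first occurrence. *)
Lemma s1_nonnegP x : s1_nonneg x ->
  (exists a b, x = s2 ^- a * s2 ^+ b) \/
  (exists a b y, s1_nonneg y /\ x = s2 ^- a * s2 ^+ b * s1 * y).
Proof.
have mulr a b : s2 * (s2 ^- a * s2 ^+ b) = s2 ^- a * s2 ^+ b.+1.
  by rewrite mulgA (commuteV (commuteX a (commute_refl s2))) -mulgA -expgS.
have mulV a b : s2^-1 * (s2 ^- a * s2 ^+ b) = s2 ^- a.+1 * s2 ^+ b.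
  by rewrite mulgA -invgM -expgSr.
case=> w; elim: w x => [|l w IH] x /=.
  by move=> _ <-; left; exists 0, 0; rewrite invg1 mul1g.
case/andP=> /braid_letter_nonneg le Nw <-; rewrite -cat1s braidM.
case: le => ->.
- right; exists 0, 0, (braid w); split; first by exists w.
  by rewrite invg1 !mul1g.
- case: (IH _ Nw erefl) => [[a [b ->]]|[a [b [y [Ny ->]]]]].
    by left; exists a, b.+1.
  by right; exists a, b.+1, y; rewrite -mulr !mulgA.
- case: (IH _ Nw erefl) => [[a [b ->]]|[a [b [y [Ny ->]]]]].
    by left; exists a.+1, b.
  by right; exists a.+1, b, y; rewrite -mulV !mulgA.
Qed.

Lemma dehornoy_cone_s1 x y : s1_nonneg x -> s1_nonneg y ->
  dehornoy_cone (x * s1 * y).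
Proof.
case=> v vP <- [w wP <-]; exists ord0; exists (v ++ sig1 :: w).
  rewrite /ipositive_word !all_cat has_cat /= vP wP orbT !andbT.
  by apply/andP; split; apply/allP.
by rewrite -cat1s !braidM mulgA.
Qed.

(** * Exponent sum *)

Definition letter_sign (l : letter) : int := if l.2 then 1%R else (-1)%R.

Definition word_exponent (w : word) : int :=
  foldr (fun l n => letter_sign l + n)%R 0%R w.

Lemma word_exponent_cat v w :
  word_exponent (v ++ w) = (word_exponent v + word_exponent w)%R.
Proof. by elim: v => [|l v IH] /=; rewrite ?GRing.add0r // IH GRing.addrA. Qed.

Lemma word_exponent_eq v w : braid_eq v w -> word_exponent v = word_exponent w.
Proof.
elim=> // [u' v' w' _ -> //|u1 u2 v1 v2 _ eu _ ev|[i []] //].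
by rewrite !word_exponent_cat eu ev.
Qed.

Definition exponent (x : B3) : int := word_exponent (repr x).

Lemma exponent_braid w : exponent (braid w) = word_exponent w.
Proof. exact/word_exponent_eq/repr_braid. Qed.

Lemma exponentM x y : exponent (x * y) = (exponent x + exponent y)%R.
Proof.
rewrite -(braid_repr x) -(braid_repr y) -braidM !exponent_braid.
exact: word_exponent_cat.
Qed.

Lemma exponent1 : exponent 1 = 0%R.
Proof. exact: exponent_braid [::]. Qed.

Lemma exponentV x : exponent x^-1 = (- exponent x)%R.
Proof.
apply/eqP; rewrite -GRing.addr_eq0 -exponentM mulVg exponent1; exact: eqxx.
Qed.

Lemma exponentX x n : exponent (x ^+ n) = (exponent x *+ n)%R.
Proof.
elim: n => [|n IH]; first exact: exponent1.
by rewrite expgS exponentM IH GRing.mulrS.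
Qed.

Lemma commutator_exponent x : commutator_subgroup B3 x -> exponent x = 0%R.
Proof.
apply: (@commutator_subgroup_sub _ [set x | exponent x = 0%R]) => [|y z] /=.
  apply: subgroupP => /= [|y z ey ez|y ey].
  - exact: exponent1.
  - by rewrite exponentM ey ez GRing.addr0.
  - by rewrite exponentV ey GRing.oppr0.
rewrite /commg /conjg !exponentM !exponentV.
by rewrite [(exponent y + _)%R]GRing.addrC GRing.addKr GRing.addNr.
Qed.

Lemma commutator_s2 a b : commutator_subgroup B3 (s2 ^- a * s2 ^+ b) ->
  s2 ^- a * s2 ^+ b = 1.
Proof.
move/commutator_exponent; rewrite exponentM exponentV !exponentX.
rewrite exponent_braid /= GRing.addr0 GRing.addrC => /eqP.
by rewrite GRing.subr_eq0 !natz => /eqP [->]; rewrite mulVg.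
Qed.

(** * A sequence of commutators decreasing to the identity *)

Notation u := (s2^-1 * s1).

Definition descent (n : nat) : B3 := u ^ (s2 ^+ n).

Lemma s2_garside : s2 ^ garside = s1.
Proof. exact/garside_conjr/braid_rel. Qed.

(** As Delta conjugates sigma2 to sigma1, u is the commutator of sigma2 and
    Delta. *)
Lemma descent_commutator n : commutator_subgroup B3 (descent n).
Proof.
have -> : descent n = [~ s2, garside] ^ (s2 ^+ n).
  by rewrite commgEl s2_garside.
by rewrite conjRg; exact: commutator_subgroupR.
Qed.

Lemma descentE n : descent n = s2 ^- n.+1 * s1 * s2 ^+ n.
Proof. by rewrite /descent /conjg expgS invgM !mulgA. Qed.

Lemma descent_pos n : dehornoy_cone (descent n).
Proof.
rewrite descentE; apply: dehornoy_cone_s1.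
  by rewrite -expVgn; exact: s1_nonnegX s1_nonneg_s2V.
exact: s1_nonnegX s1_nonneg_s2.
Qed.

Lemma s2_conj_s1 : s2 ^ s1 = s2 * s1 * s2^-1.
Proof.
apply: (mulgI s1); rewrite mulVKg; apply: (mulIg s2).
by rewrite !mulgA mulgVK braid_rel.
Qed.

(** Every 1-positive braid c has the form on the right, by [s1_nonnegP], and
    the claim is that descent n < c. *)
Lemma descent_small a b y n : s1_nonneg y -> a <= n ->
  dehornoy_cone ((descent n)^-1 * (s2 ^- a * s2 ^+ b * s1 * y)).
Proof.
move=> Ny le_an.
have e : s2 ^+ n.+1 * (s2 ^- a * s2 ^+ b) = s2 ^+ (n - a + b).+1.
  rewrite -[in LHS](subnK le_an) -addSn expgnDr mulgA mulgK -expgnDr.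
  by rewrite addSn.
have -> : (descent n)^-1 * (s2 ^- a * s2 ^+ b * s1 * y) =
    s2 ^- n * (s2 ^+ (n - a + b).+1) ^ s1 * y.
  by rewrite descentE !invgM invgK -e /conjg !mulgA.
(* The exponent is positive, so at least one factor s2 ^ s1, and with it the
   letter sigma1, survives. *)
rewrite conjXg s2_conj_s1 expgS; set z := s2 * s1 * s2^-1.
have -> : s2 ^- n * (z * z ^+ (n - a + b)) * y =
    s2 ^- n * s2 * s1 * (s2^-1 * (z ^+ (n - a + b) * y)).
  by rewrite /z !mulgA.
have N2V := s1_nonneg_s2V; have N2 := s1_nonneg_s2.
apply: dehornoy_cone_s1.
  by apply: s1_nonnegM => //; rewrite -expVgn; exact: s1_nonnegX.
apply: s1_nonnegM => //; apply: s1_nonnegM => //; apply: s1_nonnegX.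
by do 2?apply: s1_nonnegM => //; exact: s1_nonneg_s1.
Qed.

(** The braid relation in terms of u: it ties three consecutive terms of the
    sequence together, so that two of them determine the third. *)
Lemma descent_rec : u ^ (s2 ^+ 2) * u = u ^ s2.
Proof.
rewrite /conjg !expgS mulg1 !invgM !mulgA mulgK.
rewrite -3!mulgA [s1 * _]mulgA braid_rel.
by rewrite !mulgA !mulgVK.
Qed.

(** * Generation of the commutator subgroup *)

Lemma subgroup_full (H : set B3) :
  subgroup H -> H s1 -> H s2 -> forall x, H x.
Proof.
move=> sH H1 H2 x; rewrite -(braid_repr x); elim: (repr x) => [|l w IH].
  exact: subgroup1 sH.
rewrite -cat1s braidM; apply: subgroupM => //.
by case: (braid_letter l) => ->; do ?apply: subgroupV.
Qed.

Lemma commutator_sub_normal (K : set B3) : subgroup K ->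
  (forall x g, K x -> K (x ^ g)) -> K [~ s2, s1] ->
  commutator_subgroup B3 `<=` K.
Proof.
move=> sK nK K21; apply: commutator_subgroup_sub => // x y.
have sC z := subgroup_commute_mod z sK nK.
have K1 : forall z, K [~ z, s1].
  by apply: (subgroup_full (sC _)) => //=; rewrite commgg; exact: subgroup1.
have K2 : forall z, K [~ z, s2].
  apply: (subgroup_full (sC _)) => /=.
    by rewrite -invgR; exact: subgroupV.
  by rewrite commgg; exact: subgroup1.
by apply: (subgroup_full (sC y)) => /=; rewrite -invgR; apply: subgroupV.
Qed.

Lemma descent_generate C N : subgroup C ->
  (forall n, N <= n -> C (descent n)) -> commutator_subgroup B3 `<=` C.
Proof.
move=> sC CN.
(* As a is arbitrary, the conjugators s2 ^+ n * s2 ^- a with N <= n are all the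
   powers of s2; this form of them turns induction on a into the descent from
   the terms that are known to lie in C. *)
pose K := [set x | forall a n, N <= n -> C (x ^ (s2 ^+ n * s2 ^- a))].
have powSS n a : s2 ^+ n.+1 * s2 ^- a.+1 = s2 ^+ n * s2 ^- a.
  by rewrite !expgSr invgM mulgA mulgK.
have sK : subgroup K.
  apply: subgroupP => [a n _|x y Kx Ky a n leN|x Kx a n leN].
  - by rewrite conj1g; exact: subgroup1.
  - by rewrite conjMg; apply: subgroupM; [|exact: Kx|exact: Ky].
  - by rewrite conjVg; apply: subgroupV => //; exact: Kx.
have KM x y : K x -> K y -> K (x * y) by exact: subgroupM sK.
have KV x : K x -> K x^-1 by exact: subgroupV sK.
have Ku : K u.
  elim=> [|a IH] n leN; first by rewrite invg1 mulg1; exact: CN.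
  have e : u ^ (s2 ^+ n.+1 * s2 ^- a) * u ^ (s2 ^+ n * s2 ^- a.+1) =
      u ^ (s2 ^+ n * s2 ^- a).
    rewrite -(powSS n.+1 a) -(powSS n a); set g := s2 ^+ n * s2 ^- a.+1.
    have -> : s2 ^+ n.+2 * s2 ^- a.+1 = s2 ^+ 2 * g.
      by rewrite mulgA -expgnDr add2n.
    have -> : s2 ^+ n.+1 * s2 ^- a.+1 = s2 * g by rewrite mulgA -expgS.
    by rewrite [u ^ (s2 ^+ 2 * _)]conjgM -conjMg descent_rec -conjgM.
  rewrite -(mulKg (u ^ (s2 ^+ n.+1 * s2 ^- a)) (u ^ _)) e.
  apply: subgroupM => //; last exact: IH.
  by apply: subgroupV => //; apply: IH; exact: leqW.
have nK2 x : K x -> K (x ^ s2).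
  by move=> Kx a n leN; rewrite -conjgM mulgA -expgS; apply: Kx; exact: leqW.
have nK2V x : K x -> K (x ^ s2^-1).
  by move=> Kx a n leN; rewrite -conjgM -powSS mulgA expgS mulKg; exact: Kx.
have nK x g : K x -> K (x ^ g).
  pose NK := [set g | forall x, K x <-> K (x ^ g)].
  have sN : subgroup NK.
    apply: subgroupP => /= [y|g1 g2 H1 H2 y|g1 H1 y].
    - by rewrite conjg1.
    - by rewrite conjgM -H2 -H1.
    - by rewrite [K (y ^ _)]H1 conjgKV.
  have N2 : NK s2.
    by move=> y; split=> [/nK2 //|/nK2V]; rewrite conjgK.
  have Nu : NK u.
    move=> y; split=> Ky.
      by rewrite /conjg; apply: (KM); [exact: KV | exact: KM].
    rewrite -(conjgK u y) /conjg invgK; apply: (KM) => //.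
    by apply: KM => //; exact: KV.
  have N1 : NK s1 by rewrite -(mulVKg s2 s1); exact: (subgroupM sN N2 Nu).
  by move=> Kx; apply: (subgroup_full sN N1 N2 g x).1.
move=> x /(commutator_sub_normal sK nK) Kx.
have {}Kx : K x.
  apply: Kx; rewrite (_ : [~ _, _] = (u ^ s2)^-1 * u).
    by apply: KM => //; apply: KV; exact: nK.
  by rewrite /commg /conjg !invgM !invgK !mulgA mulgK.
by have := Kx N N (leqnn N); rewrite mulgV conjg1.
Qed.

Unset Implicit Arguments.

Theorem theorem1p3 (C : set B3) :
  let F2 := commutator_subgroup B3 in
  let P := F2 `&` dehornoy_cone in
  subgroup C -> C `<=` F2 -> convex_in F2 (cone_lt P) C ->
  C = [set 1] \/ C = F2.
Proof.
move=> F2 P sC CF2 cvxC.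
have sF2 : subgroup F2 := subgroup_commutator _.
have [C1|/existsNP [c /not_implyP [Cc c1]]] := pselect (forall c, C c -> c = 1).
  by left; apply/seteqP; split=> [x /C1 //|x ->]; exact: subgroup1.
right; apply/seteqP; split=> //.
wlog Nc : c Cc c1 / s1_nonneg c.
  move=> H; have [Nc|Nc] := s1_nonneg_total c; first exact: (H c).
  apply: (H c^-1) => //; first exact: subgroupV.
  by move/(congr1 inv); rewrite invgK invg1.
have [[a [b cE]]|[a [b [y [Ny cE]]]]] := s1_nonnegP Nc.
  by case: c1; rewrite cE; apply: commutator_s2; rewrite -cE; exact: CF2.
apply: (descent_generate (N := a)) => // n le_an.
have Fn := descent_commutator n.
apply: (cvxC 1 _ c) => //; first exact: subgroup1.
  by split; rewrite invg1 mul1g //; exact: descent_pos.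
split; last by rewrite cE; exact: descent_small.
by apply: (subgroupM sF2); [exact: (subgroupV sF2) | exact: CF2].
Qed.
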